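(* Let $\lambda$ be an uncountable cardinal and assume (i) $\mu^{\omega}=\mu^+$ for each cardinal $\mu<\lambda$ with $\operatorname{cf}(\mu)=\omega$, and (ii) $\Box_\mu$ holds for each singular cardinal $\mu<\lambda$ with $\operatorname{cf}(\mu)=\omega$. Then $[\lambda,\kappa,\omega]\Rightarrow\omega_1$ holds whenever $\omega_1\le\kappa\le\lambda$.
   Context: $\Box_\mu$ is Jensen's square principle. For a function $f$ and set $A$, $I_f(A)=\{\xi\in\operatorname{ran}(f):|A\cap f^{-1}\{\xi\}|=1\}$. A $(\lambda,\kappa,\mu)$-system is a family $\mathcal A$ with $|\mathcal A|=\lambda$, $|A|=\kappa$ for all $A\in\mathcal A$, and $|A\cap A'|<\mu$ for distinct $A,A'\in\mathcal A$. For cardinals $\lambda\ge\kappa\ge\rho\ge\omega$ and $\mu\le\kappa$, $[\lambda,\kappa,\mu]\Rightarrow\rho$ means: for every $(\lambda,\kappa,\mu)$-system $\mathcal A$ there is $f:\bigcup\mathcal A\to\rho$ with $|\rho\setminus I_f(A)|<\rho$ for all $A\in\mathcal A$. *)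

(* Defs.v *)
(* Cardinals are represented by Types (compared by
   injections/bijections); ordinals by well-ordered types. *)
From Stdlib Require Import Classical.

Definition card_le (A B : Type) : Prop :=
  exists f : A -> B, forall x y, f x = f y -> x = y.
Definition card_eq (A B : Type) : Prop :=
  exists (f : A -> B) (g : B -> A),
    (forall x, g (f x) = x) /\ (forall y, f (g y) = y).
Definition card_lt (A B : Type) : Prop := card_le A B /\ ~ card_le B A.

Definition is_succ_card (M N : Type) : Prop :=
  card_lt M N /\ forall Y : Type, card_lt M Y -> card_le N Y.

Record WO := {
  wo_car :> Type;
  wo_lt : wo_car -> wo_car -> Prop;
  wo_irrefl : forall x, ~ wo_lt x x;
  wo_trans : forall x y z, wo_lt x y -> wo_lt y z -> wo_lt x z;
  wo_total : forall x y, wo_lt x y \/ x = y \/ wo_lt y x;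
  wo_wf : well_founded wo_lt }.
Arguments wo_lt {w}.

Definition initial_ordinal (M : WO) : Prop :=
  forall x : M, card_lt {y : M | wo_lt y x} M.

(** cf(M) = omega: there is an omega-sequence unbounded in M
    (this forces M to be a limit ordinal, so cf(M) = omega exactly). *)
Definition cof_omega (M : WO) : Prop :=
  exists s : nat -> M, forall x : M, exists n, wo_lt x (s n).

Definition singular (M : WO) : Prop :=
  exists S : M -> Prop,
    (forall x : M, exists y, S y /\ (wo_lt x y \/ x = y)) /\
    card_lt {y : M | S y} M.

Definition is_limit {P : WO} (a : P) : Prop :=
  (exists b, wo_lt b a) /\
  forall b, wo_lt b a -> exists c, wo_lt b c /\ wo_lt c a.

Definition limit_point {P : WO} (C : P -> Prop) (b : P) : Prop :=
  (exists d, wo_lt d b) /\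
  forall d, wo_lt d b -> exists e, C e /\ wo_lt d e /\ wo_lt e b.

Definition club_in {P : WO} (a : P) (C : P -> Prop) : Prop :=
  (forall b, C b -> wo_lt b a) /\
  (forall b, wo_lt b a -> exists c, C c /\ wo_lt b c) /\
  (forall b, wo_lt b a -> limit_point C b -> C b).

Definition otp_le {P : WO} (C : P -> Prop) (M : WO) : Prop :=
  exists g : {b : P | C b} -> M,
    forall x y, wo_lt (proj1_sig x) (proj1_sig y) -> wo_lt (g x) (g y).

Definition square (M : WO) : Prop :=
  exists P : WO, initial_ordinal P /\ is_succ_card M P /\
  exists C : P -> P -> Prop,
    forall a : P, is_limit a ->
      club_in a (C a) /\ otp_le (C a) M /\
      forall b, wo_lt b a -> limit_point (C a) b ->
        forall c, C b c <-> (C a c /\ wo_lt c b).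

Definition system (lam kap mu : Type) (X : Type) (F : (X -> Prop) -> Prop) : Prop :=
  card_eq {A : X -> Prop | F A} lam /\
  (forall A, F A -> card_eq {x : X | A x} kap) /\
  (forall A B, F A -> F B -> A <> B -> card_lt {x : X | A x /\ B x} mu).

Definition I_f {X R : Type} (f : X -> R) (A : X -> Prop) (xi : R) : Prop :=
  exists! x, A x /\ f x = xi.

Definition arrows (lam kap mu rho : Type) : Prop :=
  forall (X : Type) (F : (X -> Prop) -> Prop), system lam kap mu X F ->
    exists f : X -> rho,
      forall A, F A -> card_lt {xi : rho | ~ I_f f A xi} rho.

(* Main.v *)
(** Call an indexed family of uncountable sets [A a] with finite pairwise
    intersections "nice" if there are uncountable [A' a <= A a] such that each
    [A a] meets the union of the other [A' b] in a countable set; colouring the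
    disjointified [A' a] injectively and everything else by one colour then
    gives the required colouring.

    Niceness is proved by induction on the number theta of sets.  Since two sets
    share only finitely many points, a set is determined by any infinite sequence
    of its points, so a set D of points meets at most |D|^omega members
    of the family in an infinite set.  One looks for a rank r on the indices with
    fewer than theta indices below any level, such that every [A a] meets
    the sets of smaller rank (or suitably thinned versions of them) in a countable
    set; each level is then treated by the induction hypothesis.
    - If nu^omega < theta for all nu < theta, close initial segments under
      "infinitely many points of A a have been captured, hence so is a".
    - Otherwise hypothesis (i) forces theta = mu^+ with mu singular of
      cofinality omega.  Here the closed sets are the ordinals i < mu^+ such that
      every a capturable from some j < i lies below i, where a is capturable
      from j if [A a] meets infinitely one of countably many sets of size < mu
      read off from the square sequence at j; coherence of the square
      sequence shows that an [A a] with a >= i has only countably many points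
      below i. *)
Require Import Defs.
From mathcomp Require Import ssreflect ssrfun ssrbool eqtype boolp wochoice.
From Stdlib Require Import Lia Cantor Inverse_Image.

(** * Well-orders and cardinal arithmetic *)

Lemma card_le_refl (A : Type) : card_le A A.
Proof. by exists (fun x => x). Qed.

Lemma card_le_trans (B A C : Type) : card_le A B -> card_le B C -> card_le A C.
Proof. by move=> [f fi] [g gi]; exists (fun x => g (f x)) => x y /gi/fi. Qed.

Lemma card_le_rel (A B : Type) (R : A -> B -> Prop) :
  (forall a, exists b, R a b) -> (forall a a' b, R a b -> R a' b -> a = a') ->
  card_le A B.
Proof.
move=> /choice [f Rf] inj; exists f => x y E.
by apply: (inj x y (f x)); [exact: Rf | rewrite E; exact: Rf].
Qed.

Lemma sub_card_le (X B : Type) (P : X -> Prop) (R : X -> B -> Prop) :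
  (forall x, P x -> exists b, R x b) ->
  (forall x y b, P x -> P y -> R x b -> R y b -> x = y) ->
  card_le {x | P x} B.
Proof.
move=> ex inj; apply: (card_le_rel _ _ (fun a b => R (proj1_sig a) b)).
  by move=> [x Px] /=; exact: ex.
by move=> [x Px] [y Py] b /= r1 r2; apply: eq_exist; apply: (inj x y b).
Qed.

(** A coding relation on all of [X] can be picked by [choice] for many [P] at once without carrying
    membership proofs. *)
Lemma sub_card_code (X B : Type) (P : X -> Prop) : card_le {x | P x} B ->
  exists R : X -> B -> Prop, (forall x, P x -> exists b, R x b) /\
    (forall x y b, R x b -> R y b -> x = y).
Proof.
move=> [f fi]; exists (fun x b => exists p : P x, f (exist _ x p) = b); split.
  by move=> x p; exists (f (exist _ x p)); exists p.
by move=> x y b [p e] [q e']; move: e; rewrite -e' => /fi [].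
Qed.

Lemma sub_card_mono (X : Type) (P Q : X -> Prop) :
  (forall x, P x -> Q x) -> card_le {x | P x} {x | Q x}.
Proof.
move=> PQ; apply: (sub_card_le _ _ _ (fun x b => x = proj1_sig b)).
  by move=> x Px; exists (exist _ x (PQ x Px)).
by move=> x y b _ _ -> ->.
Qed.

Lemma sub_card_type (X : Type) (P : X -> Prop) : card_le {x | P x} X.
Proof. by apply: (sub_card_le _ _ _ eq) => [x _|x y b _ _ -> ->]; [exists x|]. Qed.

Lemma card_lt_le_trans (B A C : Type) : card_lt A B -> card_le B C -> card_lt A C.
Proof.
move=> [ab nba] bc; split; first exact: card_le_trans ab bc.
by move=> ca; apply: nba; apply: card_le_trans bc ca.
Qed.

Lemma card_le_lt_trans (B A C : Type) : card_le A B -> card_lt B C -> card_lt A C.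
Proof.
move=> ab [bc ncb]; split; first exact: card_le_trans ab bc.
by move=> ca; apply: ncb; apply: card_le_trans ca ab.
Qed.

Lemma wo_min (W : WO) (P : W -> Prop) : (exists x, P x) ->
  exists x, P x /\ forall y, P y -> ~ wo_lt y x.
Proof.
move=> [x Px]; elim/(well_founded_ind (wo_wf W)): x Px => x IH Px.
case: (EM (exists y, P y /\ wo_lt y x)) => [[y [Py yx]]|N]; first exact: IH yx Py.
by exists x; split=> // y Py yx; apply: N; exists y.
Qed.

Lemma wo_nlt (W : WO) (x y : W) : ~ wo_lt x y -> y = x \/ wo_lt y x.
Proof. by case: (wo_total W x y) => [//|[->|]]; auto. Qed.

Lemma wo_lt_nlt (W : WO) (x y z : W) : wo_lt x y -> ~ wo_lt z y -> wo_lt x z.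
Proof. by move=> xy /wo_nlt [<-//|yz]; apply: wo_trans xy yz. Qed.

Lemma wo_nlt_lt (W : WO) (x y z : W) : ~ wo_lt y x -> wo_lt y z -> wo_lt x z.
Proof. by move=> /wo_nlt [->//|xy] yz; apply: wo_trans xy yz. Qed.

Lemma wo_nlt_trans (W : WO) (x y z : W) : ~ wo_lt y x -> ~ wo_lt z y -> ~ wo_lt z x.
Proof. by move=> yx zy zx; apply: zy; apply: wo_lt_nlt zx yx. Qed.

Lemma wo_rec (W : WO) (B : Type) (F : forall w : W, (forall v, wo_lt v w -> B) -> B) :
  exists f : W -> B, forall w, f w = F w (fun v _ => f v).
Proof.
exists (Fix (wo_wf W) (fun _ => B) F) => w.
apply: (Fix_eq (wo_wf W) (fun _ => B) F) => x f g fg; congr (F x _).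
by apply: functional_extensionality_dep => y; apply: functional_extensionality_dep => p.
Qed.

(** Recursion gives each [w] a value not yet taken; were all of [M] taken, [M] would embed in the
    segment below [w]. *)
Lemma wo_embed (W : WO) (M : Type) :
  (forall w : W, ~ card_le M {v | wo_lt v w}) -> card_le W M.
Proof.
move=> H; case: (EM (exists m : M, True)) => [[m0 _]|N]; last first.
  have ex : forall w : W, False.
    by move=> w; apply: (H w); apply: (card_le_rel _ _ (fun _ _ => True)) => m; case: N; exists m.
  by apply: (card_le_rel _ _ (fun _ _ => True)) => w; case: (ex w).
(* [m0] is the default for an exhausted [M]; [f_new] shows that this never happens. *)
have [f fE] := wo_rec W M
  (fun w rec => match pselect (exists m, forall v (p : wo_lt v w), rec v p <> m) with
                | left h => sval (cid h) | right _ => m0 end).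
have f_new w v : wo_lt v w -> f v <> f w.
  move=> vw; rewrite (fE w); case: pselect => [h|Hn]; first exact: (svalP (cid h)).
  case: (H w); apply: (card_le_rel _ _ (fun m v => f (proj1_sig v) = m)); last first.
    by move=> m m' b -> ->.
  move=> m; apply: contrapT => Hm; apply: Hn; exists m => u p E.
  by apply: Hm; exists (exist _ u p).
exists f => x y E; case: (wo_total W x y) => [/f_new|[//|/f_new]]; first by [].
by move=> /(_ (esym E)).
Qed.

(** The library provides a reflexive relation with unique least elements. Least elements of sets of
    two or three points give the order axioms, and the strict part is taken. *)
Lemma zermelo (T : Type) : exists W : WO, card_le T W /\ card_le W T.
Proof.
have [R Rwo] := well_ordering_principle {classic T}.
pose lt (x y : T) := R x y /\ x <> y.
have minE (P : T -> Prop) : (exists x, P x) -> exists z, P z /\ forall y, P y -> R z y.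
  move=> [x Px].
  have [|z [[/asboolP Pz Hz] _]] := Rwo (fun x => `[< P x >]).
    by exists x; apply/asboolP.
  by exists z; split=> // y Py; apply: Hz; apply/asboolP.
have tot x y : R x y \/ R y x.
  have [|z [[->|->] Hz]] := minE (fun z => z = x \/ z = y); first by exists x; left.
    by left; apply: Hz; right.
  by right; apply: Hz; left.
have refl x : R x x by case: (tot x x).
have anti x y : R x y -> R y x -> x = y.
  move=> xy yx; have [|z [_ zu]] := Rwo (fun z => `[< z = x \/ z = y >]).
    by exists x; apply/asboolP; left.
  have zx : z = x.
    by apply: zu; split; [apply/asboolP; left | move=> t /asboolP [->|->]].
  rewrite -zx; apply: zu; split; [by apply/asboolP; right | by move=> t /asboolP [->|->]].
have trans x y z : lt x y -> lt y z -> lt x z.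
  move=> [xy nxy] [yz nyz]; have xz : x <> z.
    by move=> E; apply: nyz; apply: anti => //; rewrite -E.
  split=> //; have [|t [Ht Rt]] := minE (fun t => t = x \/ t = y \/ t = z).
    by exists x; left.
  case: Ht Rt => [->|[->|->]] Rt.
  - by apply: Rt; right; right.
  - by case: nxy; apply: anti => //; apply: Rt; left.
  - by case: nyz; apply: anti => //; apply: Rt; right; left.
have irr x : ~ lt x x by case.
have total x y : lt x y \/ x = y \/ lt y x.
  case: (EM (x = y)) => [->|n]; first by right; left.
  by case: (tot x y) => r; [left|right; right]; split=> // /esym.
have wf : well_founded lt.
  move=> x; apply: contrapT => nx.
  have [|z [nz Hz]] := minE (fun x => ~ Acc lt x); first by exists x.
  apply: nz; constructor=> y [yz nyz]; apply: contrapT => ny.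
  by apply: nyz; apply: anti => //; apply: Hz.
by exists (Build_WO T lt irr trans total wf); split; apply: card_le_refl.
Qed.

Lemma sub_wo (W : WO) (P : W -> Prop) : exists V : WO,
  card_le V {x | P x} /\ card_le {x | P x} V /\
  forall v : V, exists w, P w /\ card_le {u : V | wo_lt u v} {u : W | wo_lt u w}.
Proof.
pose lt (x y : {x | P x}) := wo_lt (proj1_sig x) (proj1_sig y).
have irr x : ~ lt x x by exact: wo_irrefl.
have trans x y z : lt x y -> lt y z -> lt x z by exact: wo_trans.
have total x y : lt x y \/ x = y \/ lt y x.
  case: (wo_total W (proj1_sig x) (proj1_sig y)) => [|[E|]]; [by left| |by right;right].
  by right; left; apply: eq_sig_hprop E => ? ? ?; exact: Prop_irrelevance.
have wf : well_founded lt by apply: wf_inverse_image; exact: wo_wf.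
exists (Build_WO _ lt irr trans total wf); split; [|split]; try exact: card_le_refl.
move=> [w Pw] /=; exists w; split=> //.
apply: (sub_card_le _ _ _ (fun u b => proj1_sig u = proj1_sig b)).
  by move=> [u Pu] uw; exists (exist _ u uw).
by move=> x y b _ _ E E'; apply: eq_sig_hprop; [move=> ? ? ?; exact: Prop_irrelevance|rewrite E E'].
Qed.

Lemma card_le_total (A B : Type) : card_le A B \/ card_le B A.
Proof.
have [W [AW WA]] := zermelo A.
case: (EM (exists w : W, card_le B {v | wo_lt v w})) => [[w Bw]|N].
  right; apply: card_le_trans Bw _; apply: card_le_trans WA; exact: sub_card_type.
left; apply: card_le_trans AW _; apply: wo_embed => w Bw; apply: N; by exists w.
Qed.

Lemma card_nle_lt (A B : Type) : ~ card_le B A -> card_lt A B.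
Proof. by move=> N; case: (card_le_total A B). Qed.

Lemma card_nlt_le (A B : Type) : ~ card_lt A B -> card_le B A.
Proof. by move=> N; apply: contrapT => /card_nle_lt. Qed.

(** Every type smaller than [T] embeds in a proper initial segment of a well-order of [T], so
    induction runs along that order. *)
Lemma card_ind (P : Type -> Prop) :
  (forall T : Type, (forall Y : Type, card_lt Y T -> P Y) -> P T) -> forall T, P T.
Proof.
move=> H T; have [W [TW WT]] := zermelo T.
have PW (x : W) : forall Y, card_le Y {v | wo_lt v x} -> P Y.
  elim/(well_founded_ind (wo_wf W)): x => x IH Y Yx; apply: H => Y' [_ nY'].
  have [V [VS [SV HV]]] := sub_wo W (fun v => wo_lt v x).
  case: (EM (exists v : V, card_le Y' {u | wo_lt u v})) => [[v Yv]|N].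
    have [w [wx vw]] := HV v; apply: (IH w wx); exact: card_le_trans Yv vw.
  case: nY'; apply: card_le_trans Yx _; apply: card_le_trans SV _.
  by apply: wo_embed => v Yv; apply: N; exists v.
apply: H => Y [_ nY]; case: (EM (exists w : W, card_le Y {v | wo_lt v w})) => [[w]|N].
  exact: PW.
case: nY; apply: card_le_trans TW _; apply: wo_embed => w Yw; apply: N; by exists w.
Qed.

(** Take the least initial segment of a well-order of [T] into which [T] embeds, or the whole order
    if there is none. *)
Lemma exists_initial (T : Type) :
  exists M : WO, initial_ordinal M /\ card_le T M /\ card_le M T.
Proof.
have [W [TW WT]] := zermelo T.
case: (EM (exists w : W, card_le T {v | wo_lt v w})) => [/wo_min [x [Tx minx]]|N].
  have [V [VS [SV HV]]] := sub_wo W (fun v => wo_lt v x).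
  exists V; split; last first.
    split; first exact: card_le_trans Tx SV.
    apply: card_le_trans VS _; apply: card_le_trans WT; exact: sub_card_type.
  move=> v; apply: card_nle_lt => Vv; have [w [wx vw]] := HV v.
  apply: (minx w) => //; apply: card_le_trans vw; apply: card_le_trans Vv.
  exact: card_le_trans Tx SV.
exists W; split=> // w; apply: card_nle_lt => Ww; apply: N; exists w.
exact: card_le_trans TW Ww.
Qed.

(** Hilbert's hotel along [s]: [None] goes to [s 0] and each [s n] moves to [s (S n)]. *)
Lemma card_le_option (T : Type) : card_le nat T -> card_le (option T) T.
Proof.
move=> [s si]; apply: (card_le_rel _ _ (fun o t => match o with
  | None => t = s 0
  | Some x => (exists n, x = s n /\ t = s (S n)) \/ (~ (exists n, x = s n) /\ t = x) end)).
  move=> [x|]; last by exists (s 0).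
  case: (EM (exists n, x = s n)) => [[n E]|N]; last by exists x; right.
  by exists (s (S n)); left; exists n.
move=> [x|] [y|] t //.
- move=> [[n [-> ->]]|[N ->]] [[m [-> E]]|[N' E]].
  + by move: E => /si [->].
  + by case: N'; exists (S n).
  + by case: N; exists (S m).
  + by rewrite E.
- by move=> [[n [-> ->]]|[N ->]] E; [move/si: E | case: N; exists 0].
- by move=> E [[n [-> E']]|[N E']]; [move: E; rewrite E' => /si | case: N; exists 0; rewrite -E'].
Qed.

Lemma nat_le_option (T : Type) : card_le nat (option T) -> card_le nat T.
Proof.
move=> [f fi].
(* [k] lies beyond the only index, if any, where [f] is [None]. *)
have [k Hk] : exists k, forall n, f (k + n) <> None.
  case: (EM (exists n, f n = None)) => [[n E]|N]; last by exists 0 => n E; apply: N; exists n.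
  by exists (S n) => m E'; have := fi n (S n + m); rewrite E E' => /(_ erefl); lia.
apply: (card_le_rel _ _ (fun n t => f (k + n) = Some t)).
  by move=> n; case E : (f (k + n)) => [t|]; [exists t | case: (Hk n)].
by move=> n m t E E'; have := fi (k + n) (k + m); rewrite E E' => /(_ erefl); lia.
Qed.

Lemma option_card_lt (Y M : Type) : card_le nat M -> card_lt Y M -> card_lt (option Y) M.
Proof.
move=> nM [_ nY]; apply: card_nle_lt => Mo; apply: nY; apply: (card_le_trans _ _ _ Mo).
by apply: card_le_option; apply: nat_le_option; apply: card_le_trans nM Mo.
Qed.

Lemma initial_seg_lt (M : WO) : initial_ordinal M -> card_le nat M ->
  forall m : M, card_lt {y | ~ wo_lt m y} M.
Proof.
move=> Mi nM m; apply: (card_le_lt_trans (option {y | wo_lt y m})); last first.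
  by apply: option_card_lt.
apply: (sub_card_le _ _ _ (fun y o => match o with
   | None => y = m | Some u => y = proj1_sig u end)).
  by move=> y /wo_nlt [->|ym]; [exists None | exists (Some (exist _ y ym))].
by move=> x y [u|] _ _ -> ->.
Qed.

(** * Products, sums and sequence spaces of infinite cardinals *)

Lemma card_le_prod (A B C D : Type) :
  card_le A B -> card_le C D -> card_le (A * C) (B * D).
Proof.
move=> [f fi] [g gi]; exists (fun p => (f (fst p), g (snd p))).
by move=> [a c] [b d] [/fi /= -> /gi /= ->].
Qed.

Lemma nat_prod_le : card_le (nat * nat) nat.
Proof.
exists to_nat => x y E; rewrite -(cancel_of_to x) -(cancel_of_to y); by rewrite E.
Qed.

(** Goedel's order on pairs: by maximum, then lexicographically. Both coordinates of a pair below
    [w] are at most the maximum of [w]. *)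
Lemma prod_wo (M : WO) : exists W : WO, card_le (M * M) W /\
  forall w : W, exists m : M,
    card_le {v : W | wo_lt v w} ({y : M | ~ wo_lt m y} * {y : M | ~ wo_lt m y}).
Proof.
pose mx (p : M * M) := if pselect (wo_lt (fst p) (snd p)) then snd p else fst p.
pose lt (p q : M * M) := wo_lt (mx p) (mx q) \/ mx p = mx q /\
  (wo_lt (fst p) (fst q) \/ fst p = fst q /\ wo_lt (snd p) (snd q)).
have mx1 p : ~ wo_lt (mx p) (fst p).
  rewrite /mx; case: pselect => [h|_ /wo_irrefl //] /(wo_trans _ _ _ _ h); exact: wo_irrefl.
have mx2 p : ~ wo_lt (mx p) (snd p).
  by rewrite /mx; case: pselect => [h /wo_irrefl //|].
have irr x : ~ lt x x.
  by case=> [/wo_irrefl //|[_ [/wo_irrefl //|[_ /wo_irrefl //]]]].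
have trans x y z : lt x y -> lt y z -> lt x z.
  case=> [a|[e a]] [b|[e' b]].
  - by left; exact: wo_trans a b.
  - by left; rewrite -e'.
  - by left; rewrite e.
  - right; split; first by rewrite e.
    case: a b => [a|[f a]] [b|[g b]].
    + by left; exact: wo_trans a b.
    + by left; rewrite -g.
    + by left; rewrite f.
    + by right; split; [rewrite f | exact: wo_trans a b].
have total x y : lt x y \/ x = y \/ lt y x.
  case: (wo_total M (mx x) (mx y)) => [|[E|]]; [by left; left | | by right; right; left].
  case: (wo_total M (fst x) (fst y)) => [|[E1|]].
  - by left; right; split=> //; left.
  - case: (wo_total M (snd x) (snd y)) => [|[E2|]].
    + by left; right; split=> //; right.
    + by right; left; rewrite (surjective_pairing x) (surjective_pairing y) E1 E2.
    + by right; right; right; split=> //; right.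
  - by right; right; right; split=> //; left.
have wf : well_founded lt.
  have H : forall m a b p, mx p = m -> fst p = a -> snd p = b -> Acc lt p.
    elim/(well_founded_ind (wo_wf M)) => m IHm.
    elim/(well_founded_ind (wo_wf M)) => a IHa.
    elim/(well_founded_ind (wo_wf M)) => b IHb p pm pa pb.
    constructor=> q [l|[e [l|[e' l]]]].
    - by apply: (IHm (mx q) _ _ _ q) => //; rewrite -pm.
    - by apply: (IHa (fst q) _ _ q) => //; rewrite -?pa // e.
    - by apply: (IHb (snd q) _ q) => //; rewrite -?pb // ?e ?e'.
  by move=> p; exact: H.
exists (Build_WO _ lt irr trans total wf); split; first exact: card_le_refl.
move=> p; exists (mx p).
have sm q : lt q p -> ~ wo_lt (mx p) (mx q).
  by case=> [l /(wo_trans _ _ _ _ l) /wo_irrefl //|[-> _] /wo_irrefl].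
apply: (sub_card_le _ _ _ (fun q u => q = (proj1_sig (fst u), proj1_sig (snd u)))).
  move=> q l.
  exists (exist _ (fst q) (wo_nlt_trans _ _ _ _ (mx1 q) (sm q l)),
          exist _ (snd q) (wo_nlt_trans _ _ _ _ (mx2 q) (sm q l))).
  exact: surjective_pairing.
by move=> x y b _ _ -> ->.
Qed.

(** If [T] embedded in a proper segment of Goedel's order, it would embed in the square of a smaller
    type, which is countable or, by induction, no larger than that type. *)
Lemma card_le_square (T : Type) : card_le nat T -> card_le (T * T) T.
Proof.
elim/card_ind: T => T IH nT; have [M [Mi [TM MT]]] := exists_initial T.
case: (EM (card_le T nat)) => [Tn|nTn].
  apply: card_le_trans nT; apply: card_le_trans nat_prod_le; exact: card_le_prod.
have [W [MW HW]] := prod_wo M.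
apply: (card_le_trans (M * M)); first exact: card_le_prod.
apply: card_le_trans MW _; apply: wo_embed => w Tw; have [m wm] := HW w.
have seg : card_lt {y | ~ wo_lt m y} T.
  apply: card_lt_le_trans MT; apply: initial_seg_lt => //; exact: card_le_trans nT TM.
have Ts := card_le_trans _ _ _ Tw wm.
case: (card_le_total nat {y | ~ wo_lt m y}) => [ns|sn].
  by case: (seg) => _; apply; apply: card_le_trans Ts _; apply: IH.
apply: nTn; apply: card_le_trans Ts _; apply: card_le_trans nat_prod_le.
exact: card_le_prod.
Qed.

Lemma card_le_sum (A B C : Type) : card_le nat C -> card_le A C -> card_le B C ->
  card_le (A + B) C.
Proof.
move=> nC [f fi] [g gi]; case: (nC) => s si; apply: card_le_trans (card_le_square C nC).
exists (fun x => match x with inl a => (f a, s 0) | inr b => (g b, s 1) end).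
by move=> [a|b] [a'|b'] [] => [/fi -> //|_ /si //|_ /si //|/gi -> //].
Qed.

Lemma card_le_prod_in (A B C : Type) : card_le nat C -> card_le A C -> card_le B C ->
  card_le (A * B) C.
Proof.
by move=> nC AC BC; apply: card_le_trans (card_le_square C nC); apply: card_le_prod.
Qed.

Lemma card_le_seq (A B : Type) : card_le A B -> card_le (nat -> A) (nat -> B).
Proof.
move=> [f fi]; exists (fun s n => f (s n)) => s t E.
by apply: functional_extensionality_dep => n; apply: fi; exact: (congr1 (fun h => h n) E).
Qed.

Lemma card_le_const_seq (T : Type) : card_le T (nat -> T).
Proof. by exists (fun t _ => t) => x y /(congr1 (fun h => h 0)). Qed.

Lemma card_le_seq_seq (T : Type) : card_le (nat -> nat -> T) (nat -> T).
Proof.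
exists (fun s n => s (fst (of_nat n)) (snd (of_nat n))) => s t E.
apply: functional_extensionality_dep => n; apply: functional_extensionality_dep => m.
by have := congr1 (fun h => h (to_nat (n, m))) E; cbv beta; rewrite cancel_of_to.
Qed.

Lemma card_lt_sum (A B C : Type) : card_le nat B -> card_lt A C -> card_lt B C ->
  card_lt (A + B) C.
Proof.
move=> nB AC BC; case: (card_le_total A B) => [AB|BA].
  apply: card_le_lt_trans BC; apply: card_le_sum => //; exact: card_le_refl.
apply: card_le_lt_trans AC; apply: card_le_sum => //; last exact: card_le_refl.
exact: card_le_trans nB BA.
Qed.

(** * Infinite and countable sets *)

Definition infinite {X : Type} (P : X -> Prop) : Prop :=
  exists s : nat -> X, (forall m n, s m = s n -> m = n) /\ forall n, P (s n).

Definition countable {X : Type} (P : X -> Prop) : Prop := card_le {x | P x} nat.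

Lemma infinite_card (X : Type) (P : X -> Prop) : infinite P <-> card_le nat {x | P x}.
Proof.
split=> [[s [si sP]]|[f fi]].
  by exists (fun n => exist _ (s n) (sP n)) => m n [] /si.
exists (fun n => proj1_sig (f n)); split=> [m n E|n]; last exact: proj2_sig.
by apply: fi; apply: eq_sig_hprop => // ? ? ?; exact: Prop_irrelevance.
Qed.

Lemma infinite_mono (X : Type) (P Q : X -> Prop) :
  (forall x, P x -> Q x) -> infinite P -> infinite Q.
Proof. by move=> PQ [s [si sP]]; exists s; split=> // n; exact: PQ. Qed.

Lemma countable_mono (X : Type) (P Q : X -> Prop) :
  (forall x, P x -> Q x) -> countable Q -> countable P.
Proof. by move=> PQ cQ; apply: card_le_trans cQ; exact: sub_card_mono. Qed.

Lemma not_countable_infinite (X : Type) (P : X -> Prop) : ~ countable P -> infinite P.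
Proof. by move=> N; apply/infinite_card; case: (card_le_total nat {x | P x}). Qed.

Lemma not_infinite_countable (X : Type) (P : X -> Prop) : ~ infinite P -> countable P.
Proof. by move=> N; apply: contrapT => /not_countable_infinite. Qed.

Lemma countable_union (X : Type) (P : nat -> X -> Prop) :
  (forall n, countable (P n)) -> countable (fun x => exists n, P n x).
Proof.
move=> H; have /choice [R HR] : forall n, exists R : X -> nat -> Prop,
    (forall x, P n x -> exists b, R x b) /\ (forall x y b, R x b -> R y b -> x = y).
  by move=> n; exact: (sub_card_code _ _ _ (H n)).
apply: card_le_trans nat_prod_le.
apply: (sub_card_le _ _ _ (fun x p => R (fst p) x (snd p))).
  by move=> x [n Px]; have [b Rb] := proj1 (HR n) x Px; exists (n, b).
by move=> x y [n b] _ _ /=; exact: (proj2 (HR n)).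
Qed.

Lemma countable_or (X : Type) (P Q : X -> Prop) :
  countable P -> countable Q -> countable (fun x => P x \/ Q x).
Proof.
move=> cP cQ; pose F n := match n with 0 => P | _ => Q end.
apply: (countable_mono _ _ (fun x => exists n, F n x)).
  by move=> x [p|q]; [exists 0 | exists 1].
by apply: countable_union => -[|n]; [exact: cP | exact: cQ].
Qed.

Lemma uncountable_union (X : Type) (U : X -> Prop) (P : nat -> X -> Prop) :
  ~ countable U -> (forall x, U x -> exists n, P n x) ->
  exists n, ~ countable (fun x => U x /\ P n x).
Proof.
move=> nU UP; apply: contrapT => N; apply: nU.
apply: (countable_mono _ _ (fun x => exists n, U x /\ P n x)).
  by move=> x Ux; have [n Px] := UP x Ux; exists n.
by apply: countable_union => n; apply: contrapT => h; apply: N; exists n.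
Qed.

Lemma unbounded_subseq (Q : nat -> Prop) : (forall N, exists n, N <= n /\ Q n) ->
  exists phi : nat -> nat, (forall m n, phi m = phi n -> m = n) /\ forall n, Q (phi n).
Proof.
move=> /choice [g Hg].
pose phi := fix phi n := match n with 0 => g 0 | S m => g (S (phi m)) end.
have mono m k : phi m < phi (S k + m).
  elim: k => [|k IH]; first by have := proj1 (Hg (S (phi m))).
  apply: PeanoNat.Nat.lt_trans IH _; exact: (proj1 (Hg (S (phi (S k + m))))).
exists phi; split=> [m n E|[|n]]; [|exact: (proj2 (Hg _))..].
case: (Compare_dec.lt_eq_lt_dec m n) => [[l|//]|l].
  by have := mono m (n - m - 1); rewrite (_ : S (n - m - 1) + m = n); lia.
by have := mono n (m - n - 1); rewrite (_ : S (m - n - 1) + n = m); lia.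
Qed.

Lemma infinite_or (X : Type) (P Q R : X -> Prop) : infinite P ->
  (forall x, P x -> Q x \/ R x) -> infinite Q \/ infinite R.
Proof.
move=> [s [si sP]] PQR; case: (EM (exists N, forall n, N <= n -> ~ Q (s n))) => [[N HN]|H].
  right; exists (fun n => s (N + n)); split=> [m n /si|n]; first by lia.
  by case: (PQR _ (sP (N + n))) => // /HN; lia.
left; have [|phi [phii Hphi]] := unbounded_subseq (fun n => Q (s n)).
  move=> N; apply: contrapT => N'; apply: H; exists N => n Nn q; apply: N'.
  by exists n.
by exists (fun n => s (phi n)); split=> // m n /si /phii.
Qed.

(** Otherwise take distinct points [s n] of [U]. No [u] in [U] bounds all [r (s n)], so [U] is the
    union over [n] of the parts with [r u] at most [r (s n)]. Each part is finite, so [U] is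
    countable. *)
Lemma uncountable_has_infinite_initial_part (X : Type) (W : WO) (U : X -> Prop) (r : X -> W) :
  ~ countable U -> exists u, U u /\ infinite (fun v => U v /\ ~ wo_lt (r u) (r v)).
Proof.
move=> nU; have [s [si sU]] := not_countable_infinite _ _ nU.
apply: contrapT => N; apply: nU.
apply: (countable_mono _ _ (fun u => exists n, U u /\ ~ wo_lt (r (s n)) (r u))).
  move=> u Uu; apply: contrapT => H; apply: N; exists u; split=> //.
  exists s; split=> // n; split=> // l; apply: H; exists n; split=> // l'.
  exact: (wo_irrefl _ _ (wo_trans _ _ _ _ l l')).
apply: countable_union => n; apply: not_infinite_countable => H; apply: N.
by exists (s n).
Qed.

Definition finite_meets {I X : Type} (A : I -> X -> Prop) : Prop :=
  forall a b, infinite (fun x => A a x /\ A b x) -> a = b.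

(** Infinitely many points of [A a] determine [a], so the sequence of their codes in [B] does. *)
Lemma card_le_capture (I X B : Type) (A : I -> X -> Prop) (D : X -> Prop) :
  finite_meets A -> card_le {x | D x} B ->
  card_le {a | infinite (fun x => A a x /\ D x)} (nat -> B).
Proof.
move=> fm /sub_card_code [R [Rex Rinj]].
apply: (sub_card_le _ _ _ (fun a t => exists s : nat -> X,
   (forall m n, s m = s n -> m = n) /\ forall n, A a (s n) /\ R (s n) (t n))).
  move=> a [s [si sP]].
  have /choice [t Ht] : forall n, exists b, R (s n) b by move=> n; apply: Rex; case: (sP n).
  by exists t, s; split=> // n; split=> //; case: (sP n).
move=> a b t _ _ [s [si Hs]] [s' [_ Hs']]; apply: fm; exists s; split=> // n.
have [As Rs] := Hs n; split=> //; have [As' Rs'] := Hs' n.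
by rewrite (Rinj _ _ _ Rs Rs').
Qed.

Lemma card_le_union (J X B C : Type) (Q : J -> Prop) (P : J -> X -> Prop) :
  card_le {j | Q j} B -> (forall j, Q j -> card_le {x | P j x} C) ->
  card_le {x | exists j, Q j /\ P j x} (B * C).
Proof.
move=> /sub_card_code [R [Rex Rinj]] H.
have /choice [S HS] : forall j, exists S : X -> C -> Prop, Q j ->
    (forall x, P j x -> exists c, S x c) /\ (forall x y c, S x c -> S y c -> x = y).
  move=> j; case: (EM (Q j)) => q; last by exists (fun _ _ => True).
  by have [S HS] := sub_card_code _ _ _ (H j q); exists S.
apply: (sub_card_le _ _ _ (fun x p => exists j, Q j /\ R j (fst p) /\ S j x (snd p))).
  move=> x [j [q Px]]; have [b Rb] := Rex j q.
  by have [c Sc] := proj1 (HS j q) x Px; exists (b, c), j.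
move=> x y [b c] _ _ [j [q [Rb Sx]]] [j' [_ [Rb' Sy]]].
move: Sy; rewrite -(Rinj _ _ _ Rb Rb') => Sy; exact: (proj2 (HS j q)) Sx Sy.
Qed.

(** * Countable cofinality and the number of sequences *)

Lemma countable_surj (X : Type) (x0 : X) : card_le X nat ->
  exists s : nat -> X, forall x, exists n, s n = x.
Proof.
move=> [f fi]; have /choice [s Hs] : forall n, exists x, forall y, f y = n -> x = y.
  move=> n; case: (EM (exists x, f x = n)) => [[x E]|N].
    by exists x => y E'; apply: fi; rewrite E.
  by exists x0 => y E; case: N; exists y.
by exists s => x; exists (f x); exact: Hs.
Qed.

(** A bound on an enumeration of [M] would put all of [M] into a segment of smaller size. *)
Lemma cof_omega_countable (M : WO) : initial_ordinal M -> card_le nat M ->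
  card_le M nat -> cof_omega M.
Proof.
move=> Mi nM Mn; have [f _] := nM.
have [s Hs] := countable_surj M (f 0) Mn.
exists s => x; apply: contrapT => N.
case: (initial_seg_lt M Mi nM x) => _; apply.
apply: (card_le_rel _ _ (fun y u => y = proj1_sig u)); last by move=> y z u -> ->.
move=> y; have h : ~ wo_lt x y.
  by move=> l; apply: N; have [n E] := Hs y; exists n; rewrite E.
by exists (exist _ y h).
Qed.

Lemma cof_omega_singular (M : WO) : card_lt nat M -> cof_omega M -> singular M.
Proof.
move=> nM [s Hs]; exists (fun y => exists n, s n = y); split.
  by move=> x; have [n l] := Hs x; exists (s n); split; [exists n | left].
apply: card_le_lt_trans nM.
apply: (sub_card_le _ _ _ (fun y n => s n = y)) => [y //|x y n _ _ -> -> //].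
Qed.

(** Every sequence is bounded, hence is a sequence in one of [M]-many smaller segments. *)
Lemma not_cof_omega_seq (M : WO) : initial_ordinal M -> card_le nat M ->
  ~ cof_omega M -> (forall Y : Type, card_lt Y M -> card_le (nat -> Y) M) ->
  card_le (nat -> M) M.
Proof.
move=> Mi nM ncof HY.
apply: (card_le_trans {s : nat -> M | exists m : M, True /\ forall n, ~ wo_lt m (s n)}).
  apply: (card_le_rel _ _ (fun s u => s = proj1_sig u)); last by move=> y z u -> ->.
  move=> s; have h : exists m : M, True /\ forall n, ~ wo_lt m (s n).
    apply: contrapT => N; apply: ncof; exists s => x; apply: contrapT => N'.
    by apply: N; exists x; split=> // n l; apply: N'; exists n.
  by exists (exist _ s h).
apply: card_le_trans (card_le_square M nM); apply: card_le_union.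
  exact: sub_card_type.
move=> m _; apply: card_le_trans (HY _ (initial_seg_lt M Mi nM m)).
apply: (sub_card_le _ _ _ (fun s t => forall n, s n = proj1_sig (t n))).
  by move=> s Hs; exists (fun n => exist _ (s n) (Hs n)).
by move=> s s' t _ _ E E'; apply: functional_extensionality_dep => n; rewrite E E'.
Qed.

Lemma succ_nat_le (W1 Y : Type) : is_succ_card nat W1 -> ~ card_le Y nat -> card_le W1 Y.
Proof. by move=> [_ H] nY; apply: H; exact: card_nle_lt. Qed.

(* As [cof_omega] holds for [omega], hypothesis [Hi] contains CH. *)
Lemma seq_card_le (W1 lam : Type) (HW1 : is_succ_card nat W1) (Hlam : card_lt nat lam)
  (Hi : forall M : WO, initial_ordinal M -> card_lt M lam -> cof_omega M ->
          is_succ_card M (nat -> M)) (M : Type) :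
  card_le M lam -> card_le W1 M -> forall Y : Type, card_lt Y M -> card_le (nat -> Y) M.
Proof.
elim/card_ind: M => M IH Ml WM Y YM.
have [N [Ni [YN NY]]] := exists_initial Y.
apply: card_le_trans (card_le_seq _ _ YN) _.
have NM : card_lt N M by exact: card_le_lt_trans NY YM.
have Nl : card_lt N lam by exact: card_lt_le_trans NM Ml.
case: (EM (card_le N nat)) => [Nn|nN].
  have [K [Ki [nK Kn]]] := exists_initial nat.
  have KW : card_le (nat -> K) W1.
    have [_] := Hi K Ki (card_le_lt_trans _ _ _ Kn Hlam) (cof_omega_countable K Ki nK Kn).
    apply; apply: card_le_lt_trans Kn _; exact: (proj1 HW1).
  apply: card_le_trans WM; apply: card_le_trans KW; apply: card_le_seq.
  exact: card_le_trans Nn nK.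
have WN := succ_nat_le _ _ HW1 nN.
have nN' : card_le nat N by case: (card_nle_lt _ _ nN).
(* In cofinality omega, [nat -> N] is the successor of [N], hence at most [M]; otherwise sequences
   in [N] are bounded and the induction hypothesis applies to [N]. *)
case: (EM (cof_omega N)) => [cN|ncN]; first by have [_] := Hi N Ni Nl cN; apply.
apply: card_le_trans (proj1 NM); apply: not_cof_omega_seq => //.
by apply: IH => //; case: Nl.
Qed.

(** * Captured sets at a successor of cofinality omega *)

Lemma succ_seg_le (M P : WO) : initial_ordinal P -> is_succ_card M P ->
  card_le nat M -> forall g : P, card_le {y | ~ wo_lt g y} M.
Proof.
move=> Pi [[MP _] Psucc] nM g; apply: card_nlt_le => /Psucc.
by case: (initial_seg_lt P Pi (card_le_trans _ _ _ nM MP) g).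
Qed.

(** Regularity of a successor cardinal: an unbounded [T] would make [P] a union of [M]-many segments
    of size at most [M]. *)
Lemma succ_bounded (M P : WO) : initial_ordinal P -> is_succ_card M P ->
  card_le nat M -> forall T : P -> Prop, card_le {t | T t} M ->
  exists h, forall t, T t -> wo_lt t h.
Proof.
move=> Pi Ps nM T TM; apply: contrapT => N.
case: (Ps) => -[_ nPM] _; apply: nPM.
apply: (card_le_trans {y : P | exists t, T t /\ ~ wo_lt t y}).
  apply: (card_le_rel _ _ (fun y u => y = proj1_sig u)); last by move=> y z u -> ->.
  move=> y; have h : exists t, T t /\ ~ wo_lt t y.
    apply: contrapT => N'; apply: N; exists y => t Tt; apply: contrapT => l.
    by apply: N'; exists t.
  by exists (exist _ y h).
apply: card_le_trans (card_le_square M nM); apply: card_le_union => // t _.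
exact: succ_seg_le.
Qed.

Lemma wo_max (W : WO) (x y : W) : exists z, ~ wo_lt z x /\ ~ wo_lt z y.
Proof.
case: (EM (wo_lt x y)) => [xy|nxy].
  exists y; split; last exact: wo_irrefl.
  by move=> yx; apply: (wo_irrefl _ _ (wo_trans _ _ _ _ xy yx)).
by exists x; split=> //; exact: wo_irrefl.
Qed.

Lemma cofinal3 (M : WO) (s : nat -> M) : (forall x, exists n, wo_lt x (s n)) ->
  forall u v w, exists n, wo_lt u (s n) /\ wo_lt v (s n) /\ wo_lt w (s n).
Proof.
move=> Hs u v w; have [y [yu yv]] := wo_max M u v; have [z [zy zw]] := wo_max M y w.
have [n zn] := Hs z; exists n; split; [|split]; try exact: wo_nlt_lt zw zn.
  by apply: wo_nlt_lt yu _; apply: wo_nlt_lt zy zn.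
by apply: wo_nlt_lt yv _; apply: wo_nlt_lt zy zn.
Qed.

(** [G j a] says that [a] is capturable from [j]: [A a] meets some [DD j n] infinitely. Each
    [DD j n] is smaller than [M], so [seqM] bounds the captured indices. If [i] is closed under
    capture and [A a] has uncountably many points below [i], infinitely many of them lie in one
    [DD j n] with [j] below [i], a contradiction. *)
Lemma square_capture (M P : WO) (Mi : initial_ordinal M) (nM : card_lt nat M)
  (s : nat -> M) (Hs : forall x, exists n, wo_lt x (s n))
  (seqM : forall Y : Type, card_lt Y M -> card_le (nat -> Y) M)
  (Pi : initial_ordinal P) (Ps : is_succ_card M P)
  (C : P -> P -> Prop)
  (HC : forall a : P, is_limit a ->
      club_in a (C a) /\ otp_le (C a) M /\
      forall b, wo_lt b a -> limit_point (C a) b ->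
        forall c, C b c <-> (C a c /\ wo_lt c b))
  (I X : Type) (A : I -> X -> Prop) (fm : finite_meets A)
  (e : I -> P) (ei : forall a b, e a = e b -> a = b)
  (Q : P -> I -> X -> Prop) (HQ : forall i b, card_le {x | Q i b x} M) :
  exists G : P -> I -> Prop,
  (forall j, card_le {a | G j a} M) /\
  forall (i : P) (a : I) (r : I -> P),
    (forall j, wo_lt j i -> forall b, G j b -> wo_lt (e b) i) ->
    ~ wo_lt (e a) i -> (forall b, ~ wo_lt (e b) (r b)) ->
    countable (fun x => A a x /\ exists b, wo_lt (e b) i /\ Q (r b) b x).
Proof.
have nM' : card_le nat M by case: nM.
have /choice [E HE] : forall g, exists R : P -> M -> Prop,
    (forall x, ~ wo_lt g x -> exists b, R x b) /\ (forall x y b, R x b -> R y b -> x = y).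
  by move=> g; apply: sub_card_code; apply: succ_seg_le.
have /choice [K HK] : forall p : P * I, exists R : X -> M -> Prop,
    (forall x, Q (fst p) (snd p) x -> exists b, R x b) /\
    (forall x y b, R x b -> R y b -> x = y).
  by move=> p; apply: sub_card_code.
(* [E g] codes the ordinals [<= g] in [M]; below [s n] there are fewer than [mu]
   codes, and [D g n] collects the points whose three codes at [g] are below [s n]. *)
pose D g n x := exists i b u v w, Q i b x /\ (E g i u /\ E g (e b) v /\ K (i, b) x w) /\
  (wo_lt u (s n) /\ wo_lt v (s n) /\ wo_lt w (s n)).
have D_card g n : card_le {x | D g n x}
    ({y | wo_lt y (s n)} * ({y | wo_lt y (s n)} * {y | wo_lt y (s n)})).
  apply: (sub_card_le _ _ _ (fun x t => exists i b, Q i b x /\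
     E g i (proj1_sig (fst t)) /\ E g (e b) (proj1_sig (fst (snd t))) /\
     K (i, b) x (proj1_sig (snd (snd t))))).
    move=> x [i [b [u [v [w [q [h [us [vs ws]]]]]]]]].
    by exists (exist _ u us, (exist _ v vs, exist _ w ws)); exists i, b.
  move=> x y [[u us] [[v vs] [w ws]]] _ _ /= [i [b [_ [Ei [Eb Kx]]]]] [i' [b' [_ [Ei' [Eb' Ky]]]]].
  move: Ky; rewrite -(proj2 (HE g) _ _ _ Ei Ei') -(ei _ _ (proj2 (HE g) _ _ _ Eb Eb')).
  exact: (proj2 (HK (i, b))) Kx.
have D_ex g i b x : Q i b x -> ~ wo_lt g i -> ~ wo_lt g (e b) -> exists n, D g n x.
  move=> q gi gb; have [u Hu] := proj1 (HE g) i gi; have [v Hv] := proj1 (HE g) _ gb.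
  have [w Hw] := proj1 (HK (i, b)) x q; have [n Hn] := cofinal3 M s Hs u v w.
  by exists n, i, b, u, v, w.
(* [C j] may be as large as [M], and is arbitrary at non-limits; it enters [DD j n] only when it is
   smaller than [M]. *)
pose small j := card_lt {c | C j c} M.
pose DD j n x := exists g, (g = j \/ small j /\ C j g) /\ D g n x.
pose G j a := exists n, True /\ infinite (fun x => A a x /\ DD j n x).
exists G; split.
  move=> j; apply: card_le_trans (card_le_square M nM').
  apply: (card_le_trans (nat * M)); last by apply: card_le_prod => //; exact: card_le_refl.
  apply: card_le_union; first exact: sub_card_type.
  move=> n _.
  have [Z [ZM HZ]] : exists Z, card_lt Z M /\ card_le {g | g = j \/ small j /\ C j g} Z.
    case: (EM (small j)) => [sj|nsj].
      exists (option {c | C j c}); split; first exact: option_card_lt.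
      apply: (sub_card_le _ _ _ (fun g o => match o with
         | None => g = j | Some u => g = proj1_sig u end)).
        by move=> g [->|[_ Cg]]; [exists None | exists (Some (exist _ g Cg))].
      by move=> x y [u|] _ _ -> ->.
    exists nat; split=> //; apply: (sub_card_le _ _ _ (fun _ _ => True)).
      by move=> *; exists 0.
    by move=> x y _ [->|[//]] [->|[//]].
  pose S := {y : M | wo_lt y (s n)}.
  have SM : card_lt (S + nat) M.
    by apply: card_lt_sum => //; [exact: card_le_refl | exact: Mi].
  have nS : card_le nat (S + nat) by exists inr => x y [].
  (* [Y] is still below [M], yet bounds both the number of [g] and the codes used for each
     [D g n]. *)
  pose Y := (Z + (S + nat))%type.
  have nY : card_le nat Y by apply: card_le_trans nS _; exists inr => x y [].
  have YM : card_lt Y M by exact: card_lt_sum.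
  have SY : card_le S Y by exists (fun x => inr (inl x)) => x y [].
  apply: card_le_trans (seqM Y YM); apply: card_le_capture => //.
  apply: card_le_trans (card_le_square Y nY); apply: card_le_union.
    by apply: card_le_trans HZ _; exists inl => x y [].
  move=> g _; apply: card_le_trans (D_card g n) _.
  by do 2!(apply: card_le_prod_in => //).
move=> i a r icl ai re; apply: contrapT => nU.
have noG j : wo_lt j i -> ~ G j a by move=> ji /(icl j ji).
set U := (fun x => _) in nU.
have /choice [be Hbe] : forall x, exists b, U x -> wo_lt (e b) i /\ Q (r b) b x.
  move=> x; case: (EM (U x)) => [[_ [b Hb]]|n]; first by exists b.
  by exists a.
case: (EM (is_limit i)) => [ilim|nlim]; last first.
  (* A non-limit [i] with an element below it has an immediate predecessor [p], and all points can
     be coded at [p]. *)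
  have [p [pi Hp]] : exists p, wo_lt p i /\ forall c, wo_lt c i -> ~ wo_lt p c.
    apply: contrapT => N; apply: nlim; split.
      have [t [_ Ut]] := not_countable_infinite _ _ nU.
      by exists (e (be (t 0))); exact: (proj1 (Hbe _ (Ut 0))).
    move=> b bi; apply: contrapT => N'; apply: N; exists b; split=> // c ci bc.
    by apply: N'; exists c.
  have [|n Hn] := uncountable_union _ _ (D p) nU.
    move=> x Ux; have [bi qx] := Hbe x Ux; apply: D_ex qx _ _; last exact: Hp.
    by move=> l; apply: (Hp _ bi); apply: wo_lt_nlt l _; exact: re.
  apply: (noG p pi); exists n; split=> //; apply: infinite_mono (not_countable_infinite _ _ Hn).
  by move=> x [[Ax _] Dx]; split=> //; exists p; split=> //; left.
(* Each point goes to some [ga x] in the club [C i]. For the least [g] with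
   infinitely many [ga x < g], either [g] is a limit point of [C i], and coherence
   makes these points part of [DD g n], or infinitely many [ga x] coincide. *)
have [[Clt [Cunb Ccl]] [[f Hf] Ccoh]] := HC i ilim.
have /choice [ga Hga] : forall x, exists g, U x -> C i g /\ wo_lt (e (be x)) g.
  move=> x; case: (EM (U x)) => [Ux|n]; last by exists i.
  by have [g Hg] := Cunb _ (proj1 (Hbe x Ux)); exists g.
have [|n nUn] := uncountable_union _ _ (fun n x => D (ga x) n x) nU.
  move=> x Ux; have [bi qx] := Hbe x Ux; have [_ bg] := Hga x Ux; apply: D_ex qx _ _.
    by move=> l; apply: (re (be x)); apply: wo_trans bg l.
  by move=> l; apply: (wo_irrefl _ _ (wo_trans _ _ _ _ bg l)).
set Un := (fun x => _) in nUn.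
have [u [[Uu _] infu]] := uncountable_has_infinite_initial_part _ _ _ ga nUn.
(* Going one step up in the club turns the weak bound [ga u] into a strict one. *)
have [g' [Cg' ug']] := Cunb _ (Clt _ (proj1 (Hga u Uu))).
pose P_inf g := infinite (fun v => Un v /\ wo_lt (ga v) g).
have infg' : P_inf g'.
  by apply: infinite_mono infu => v [Uv l]; split=> //; exact: wo_nlt_lt l ug'.
have [|g [infg ming]] := wo_min P P_inf; first by exists g'.
have gi : wo_lt g i.
  have g'i := Clt _ Cg'; case: (wo_nlt _ _ _ (ming g' infg')) => [->//|l].
  exact: wo_trans l g'i.
case: (EM (limit_point (C i) g)) => [lg|nlg].
  have Cg := Ccl g gi lg; have coh := Ccoh g gi lg.
  apply: (noG g gi); exists n; split=> //; apply: infinite_mono infg.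
  move=> x [[Ux Dx] gx]; split; first by case: Ux.
  exists (ga x); split=> //; right; split; last by apply/coh; split=> //; case: (Hga x Ux).
  (* By coherence [C g] is the part of [C i] below [g]; [f] maps it below the image of [g], a
     segment smaller than [M]. *)
  apply: card_le_lt_trans (Mi (f (exist _ g Cg))).
  apply: (sub_card_le _ _ _ (fun c y => exists p : C i c, f (exist _ c p) = proj1_sig y)).
    move=> c /coh [Cc cg]; have l := Hf (exist _ c Cc) (exist _ g Cg) cg.
    by exists (exist (fun y => wo_lt y (f (exist _ g Cg))) _ l), Cc.
  move=> c c' y _ _ [p E1] [p' E2]; rewrite -E2 in E1.
  case: (wo_total P c c') => [l|[//|l]].
    by have := Hf (exist _ c p) (exist _ c' p') l; rewrite E1 => /wo_irrefl.
  by have := Hf (exist _ c' p') (exist _ c p) l; rewrite E1 => /wo_irrefl.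
(* No club point lies strictly between [d] and [g]. By minimality of [g] only finitely many of the
   points have [ga v] below [d], so infinitely many have [ga v] equal to [d]. *)
have [d [dg Hd]] : exists d, wo_lt d g /\ forall c, C i c -> wo_lt c g -> ~ wo_lt d c.
  apply: contrapT => N; apply: nlg; split.
    by case: (infg) => t [_ Ht]; exists (ga (t 0)); case: (Ht 0).
  move=> d dg; apply: contrapT => N'; apply: N; exists d; split=> // c Cc cg dc.
  by apply: N'; exists c.
have [|inf|inf] := infinite_or _ _ (fun v => Un v /\ wo_lt (ga v) d)
  (fun v => Un v /\ ga v = d) infg.
- move=> v [Uv l]; have [Cv _] := Hga v (proj1 Uv).
  by have [->|l'] := wo_nlt _ _ _ (Hd _ Cv l); [right | left].
- exact: (ming d inf dg).
- have di := wo_trans _ _ _ _ dg gi.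
  apply: (noG d di); exists n; split=> //; apply: infinite_mono inf.
  move=> v [[Uv Dv] E1]; split; first by case: Uv.
  by exists d; split; [left | rewrite -E1].
Qed.

(** * Filtrations *)

(* [r] ranks the indices and [N i] bounds the number of those of rank at most [i].
   [q N H b] is the part of [A b] that will carry the chosen points, where [H] is
   the set of indices of smaller rank; it may depend on [H] so as to avoid [A g]
   for [g] in [H]. *)
Definition filtration {I X : Type} (A : I -> X -> Prop) (theta K0 : Type)
  (q : Type -> (I -> Prop) -> I -> X -> Prop) : Prop :=
  exists (W : WO) (r : I -> W) (N : W -> Type),
    (forall i, card_lt (N i) theta /\ card_le K0 (N i) /\
               card_le {a | ~ wo_lt i (r a)} (N i)) /\
    forall a, countable (fun x => A a x /\
      exists b, wo_lt (r b) (r a) /\ q (N (r b)) (fun g => wo_lt (r g) (r b)) b x).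

(** The rank of [a] is the supremum of the closed ordinals up to [e a]. It is itself closed, so
    [square_capture] applies to it. Closed ordinals are unbounded, so the indices up to a given rank
    are bounded in [P] and number at most [M]. *)
Lemma filtration_square (M P : WO) (Mi : initial_ordinal M) (nM : card_lt nat M)
  (cofM : cof_omega M)
  (seqM : forall Y : Type, card_lt Y M -> card_le (nat -> Y) M)
  (Pi : initial_ordinal P) (Ps : is_succ_card M P)
  (C : P -> P -> Prop)
  (HC : forall a : P, is_limit a ->
      club_in a (C a) /\ otp_le (C a) M /\
      forall b, wo_lt b a -> limit_point (C a) b ->
        forall c, C b c <-> (C a c /\ wo_lt c b))
  (I X : Type) (A : I -> X -> Prop) (fm : finite_meets A)
  (e : I -> P) (ei : forall a b, e a = e b -> a = b) (theta K0 : Type)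
  (Mth : card_lt M theta) (KM : card_le K0 M)
  (q : Type -> (I -> Prop) -> I -> X -> Prop)
  (Hq : forall N H b, card_le K0 N -> card_le {x | q N H b x} N) :
  filtration A theta K0 q.
Proof.
have nM' : card_le nat M by case: nM.
have [s Hs] := cofM.
pose Q i b x := q M (fun g => wo_lt (e g) i) b x.
have HQ i b : card_le {x | Q i b x} M by exact: Hq.
have [G [GM HG]] := square_capture M P Mi nM s Hs seqM Pi Ps C HC I X A fm e ei Q HQ.
pose closed c := forall j, wo_lt j c -> forall b, G j b -> wo_lt (e b) c.
have bounded := succ_bounded M P Pi Ps nM'.
(* [h j] exceeds [j] and everything captured from stages up to [j]. *)
have /choice [h Hh] : forall j, exists h, wo_lt j h /\
    forall j', ~ wo_lt j j' -> forall b, G j' b -> wo_lt (e b) h.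
  move=> j; have [|h Hh] := bounded (fun t => exists j', ~ wo_lt j j' /\
      (t = j' \/ exists b, G j' b /\ t = e b)).
    apply: card_le_trans (card_le_square M nM'); apply: card_le_union.
      exact: succ_seg_le.
    move=> j' _; apply: card_le_trans (card_le_option M nM').
    apply: card_le_trans (_ : card_le (option {b | G j' b}) _); last first.
      have [f fi] := GM j'; exists (fun o => match o with
         | Some b => Some (f b) | None => None end).
      by move=> [x|] [y|] // [] /fi ->.
    apply: (sub_card_le _ _ _ (fun t o => match o with
       | None => t = j' | Some b => t = e (proj1_sig b) end)).
      move=> t [->|[b [Gb ->]]]; first by exists None.
      by exists (Some (exist _ b Gb)).
    by move=> x y [b|] _ _ -> ->.
  exists h; split; first by apply: Hh; exists j; split; [exact: wo_irrefl | left].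
  by move=> j' jj' b Gb; apply: Hh; exists j'; split=> //; right; exists b.
have unb j : exists c, closed c /\ wo_lt j c.
  (* The supremum of the iterates of [h] is closed: a stage below it lies below some [t n], or
     equals it, and captures only below [t (S n)]. *)
  pose t := fix t n := match n with 0 => h j | S n => h (t n) end.
  have [|c [Hc minc]] := wo_min P (fun c => forall n, wo_lt (t n) c).
    have [|c Hc] := bounded (fun y => exists n, t n = y); last first.
      by exists c => n; apply: Hc; exists n.
    apply: card_le_trans nM'; apply: (sub_card_le _ _ _ (fun y n => t n = y)) => //.
    by move=> x y n _ _ -> ->.
  exists c; split; last by apply: wo_trans (Hc 0); exact: (proj1 (Hh j)).
  move=> k kc b Gb.
  have [n tn] : exists n, ~ wo_lt (t n) k.
    by apply: contrapT => N; apply: (minc k) => // n; apply: contrapT => l; apply: N; exists n.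
  apply: wo_trans (Hc (S n)); exact: (proj2 (Hh (t n))) tn _ Gb.
have /choice [r Hr] : forall a, exists i,
    (forall c, closed c -> ~ wo_lt (e a) c -> ~ wo_lt i c) /\
    forall j, (forall c, closed c -> ~ wo_lt (e a) c -> ~ wo_lt j c) -> ~ wo_lt j i.
  by move=> a; apply: wo_min; exists (e a).
have rle a : ~ wo_lt (e a) (r a) by apply: (proj2 (Hr a)).
have rcl a : closed (r a).
  move=> j ja b Gb.
  have [c [cc [ac jc]]] : exists c, closed c /\ ~ wo_lt (e a) c /\ wo_lt j c.
    apply: contrapT => N; apply: (proj2 (Hr a) j) => // c cc ac jc.
    by apply: N; exists c.
  exact: wo_lt_nlt (cc j jc b Gb) (proj1 (Hr a) c cc ac).
have rlt a b : wo_lt (r b) (r a) <-> wo_lt (e b) (r a).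
  split=> [l|l]; last by apply: wo_nlt_lt l; exact: rle.
  by apply: contrapT => n; apply: (proj1 (Hr b) _ (rcl a) n).
exists P, r, (fun _ => M); split.
  move=> i; split=> //; split=> //; have [c [cc ic]] := unb i.
  apply: card_le_trans (succ_seg_le M P Pi Ps nM' c).
  apply: (sub_card_le _ _ _ (fun a y => e a = proj1_sig y)); last first.
    by move=> x y b _ _ E1 E2; apply: ei; rewrite E1 E2.
  move=> a ia; have ac : ~ wo_lt c (e a).
    move=> ca; apply: ia; apply: wo_lt_nlt ic _; apply: (proj1 (Hr a)) => //.
    by move=> l; apply: (wo_irrefl _ _ (wo_trans _ _ _ _ ca l)).
  by exists (exist (fun y => ~ wo_lt c y) _ ac).
move=> a; apply: countable_mono (HG (r a) a r (rcl a) (rle a) rle).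
move=> x [Ax [b [l qx]]]; split=> //; exists b; split; first by apply/rlt.
(* [Q] describes the earlier indices by [e], the filtration by [r]; the two agree below the closed
   ordinal [r b]. *)
have E : (fun g => wo_lt (e g) (r b)) = (fun g => wo_lt (r g) (r b)).
  by apply: functional_extensionality_dep => g; apply: propext; split=> /rlt.
by rewrite /Q E.
Qed.

(** Codes for derivations in [seq_closure]: a leaf codes a base index, a node the labels and
    derivations of its premises. *)
Inductive countable_tree (V : Type) : Type :=
| leaf (v : V)
| node (l : nat -> V) (c : nat -> countable_tree V).
Arguments leaf {V}.
Arguments node {V}.

(* A tree is recovered from its labels, read along the paths coded by naturals. *)
Lemma card_countable_tree (V : Type) :
  card_le nat V -> card_le (countable_tree V) (nat -> V).
Proof.
move=> nV; apply: (card_le_trans (nat -> option V)); last first.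
  by apply: card_le_seq; exact: card_le_option.
pose enc := fix enc (t : countable_tree V) (k : nat) : option V := match t with
  | leaf v => Some v
  | node l c => match k with
    | 0 => None
    | S k => match snd (of_nat k) with
      | 0 => Some (l (fst (of_nat k)))
      | S m => enc (c (fst (of_nat k))) m end end end.
have encS l c n m : enc (node l c) (S (to_nat (n, m))) =
    match m with 0 => Some (l n) | S m => enc (c n) m end.
  change (enc (node l c) (S (to_nat (n, m)))) with
    (match snd (of_nat (to_nat (n, m))) with
     | 0 => Some (l (fst (of_nat (to_nat (n, m)))))
     | S k => enc (c (fst (of_nat (to_nat (n, m))))) k end).
  by rewrite cancel_of_to.
exists enc; elim=> [v|l c IH] [v'|l' c'] E.
- by have [->] := congr1 (fun h => h 0) E.
- by have := congr1 (fun h => h 0) E.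
- by have := congr1 (fun h => h 0) E.
- have E1 n m : enc (node l c) (S (to_nat (n, m))) = enc (node l' c') (S (to_nat (n, m))).
    by rewrite E.
  congr node; apply: functional_extensionality_dep => n.
    by have := E1 n 0; rewrite !encS => -[].
  apply: IH; apply: functional_extensionality_dep => m.
  by have := E1 n (S m); rewrite !encS.
Qed.

(** Closure under capture, stated with sequences so that derivations are countably branching trees;
    [J] holds the stages. *)
Inductive seq_closure {I X J : Type} (A : I -> X -> Prop) (B : I -> Prop)
  (Z : J -> I -> X -> Prop) : I -> Prop :=
| closure_base a : B a -> seq_closure A B Z a
| closure_capture a (b : nat -> I) (j : nat -> J) (x : nat -> X) :
    (forall n, seq_closure A B Z (b n)) -> (forall n, Z (j n) (b n) (x n)) ->
    (forall m n, x m = x n -> m = n) -> (forall n, A a (x n)) -> seq_closure A B Z a.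

Lemma seq_closure_mono (I X J : Type) (A : I -> X -> Prop) (B B' : I -> Prop)
  (Z Z' : J -> I -> X -> Prop) :
  (forall a, B a -> B' a) -> (forall j b x, Z j b x -> Z' j b x) ->
  forall a, seq_closure A B Z a -> seq_closure A B' Z' a.
Proof.
move=> BB ZZ a; elim=> [{}a /BB|{}a b j x _ IH Hz xi Ax]; first exact: closure_base.
by apply: (closure_capture _ _ _ _ b j x) => // n; apply: ZZ.
Qed.

(** A tree determines its index: subtrees determine the [b n] by induction, labels then determine
    the points [x n], and these determine [a]. *)
Lemma seq_closure_card (I X J V : Type) (A : I -> X -> Prop) (B : I -> Prop)
  (Z : J -> I -> X -> Prop) : finite_meets A -> card_le nat V ->
  card_le {a | B a} V -> (forall b, card_le {p : J * X | Z (fst p) b (snd p)} V) ->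
  card_le {a | seq_closure A B Z a} (nat -> V).
Proof.
move=> fm nV /sub_card_code [RB [RBex RBi]] HZ.
have /choice [RZ HRZ] : forall b, exists R : J * X -> V -> Prop,
    (forall x, Z (fst x) b (snd x) -> exists v, R x v) /\
    (forall x y v, R x v -> R y v -> x = y).
  by move=> b; exact: (sub_card_code _ _ _ (HZ b)).
apply: card_le_trans (card_countable_tree V nV).
pose R := fix R (t : countable_tree V) (a : I) : Prop := match t with
  | leaf v => RB a v
  | node l c => exists b j x, (forall n, R (c n) (b n)) /\
      (forall n, RZ (b n) (j n, x n) (l n)) /\
      (forall m n, x m = x n -> m = n) /\ (forall n, A a (x n)) end.
apply: (sub_card_le _ _ _ (fun a t => R t a)).
  move=> a; elim=> [{}a /RBex [v Hv]|{}a b j x _ /choice [c Hc] Hz xi Ax].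
    by exists (leaf v).
  have /choice [l Hl] : forall n, exists v, RZ (b n) (j n, x n) v.
    by move=> n; apply: (proj1 (HRZ (b n))); exact: Hz.
  by exists (node l c), b, j, x.
move=> a a' t _ _; elim: t a a' => [v|l c IH] a a'; first exact: RBi.
move=> [b [j [x [Hc [Hl [xi Ax]]]]]] [b' [j' [x' [Hc' [Hl' [_ Ax']]]]]].
apply: fm; exists x; split=> // n; split=> //.
have E : b n = b' n by exact: IH (Hc n) (Hc' n).
have H' := Hl' n; rewrite -E in H'.
by have [_ ->] := proj2 (HRZ (b n)) _ _ _ (Hl n) H'.
Qed.

(** [G0 j] closes the indices up to [j] under capture, and [r a] is the first stage containing [a].
    If [A a] had uncountably many earlier points, infinitely many would come from stages up to a
    single one below [r a], which would then contain [a]. *)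
Lemma filtration_seq_closed (O : WO) (Oi : initial_ordinal O)
  (I X : Type) (A : I -> X -> Prop) (fm : finite_meets A)
  (e : I -> O) (ei : forall a b, e a = e b -> a = b) (K0 : Type)
  (nK : card_le nat K0) (KO : card_lt K0 O)
  (seqO : forall T : Type, card_lt T O -> card_lt (nat -> T) O)
  (q : Type -> (I -> Prop) -> I -> X -> Prop)
  (Hq : forall N H b, card_le K0 N -> card_le {x | q N H b x} N) :
  filtration A O K0 q.
Proof.
have nO : card_le nat O by apply: card_le_trans nK _; case: KO.
pose L j := ({y : O | ~ wo_lt j y} + K0)%type.
pose N j := nat -> L j.
have KL j : card_le K0 (L j) by exists inr => x y [].
have KN j : card_le K0 (N j).
  by apply: card_le_trans (KL j) _; exact: card_le_const_seq.
have nN j : card_le nat (N j) by apply: card_le_trans nK _; exact: KN.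
have NO j : card_lt (N j) O.
  by apply: seqO; apply: card_lt_sum => //; exact: initial_seg_lt.
have segN j : card_le {y : O | ~ wo_lt j y} (N j).
  by apply: card_le_trans (card_le_const_seq (L j)); exists inl => x y [].
have Nmono i j : ~ wo_lt j i -> card_le (N i) (N j).
  move=> ij; apply: card_le_seq.
  have [f fi] : card_le {y : O | ~ wo_lt i y} {y : O | ~ wo_lt j y}.
    apply: sub_card_mono => y iy; exact: wo_nlt_trans iy ij.
  exists (fun x => match x with inl y => inl (f y) | inr k => inr k end).
  by move=> [x|x] [y|y] // [] => [/fi|] ->.
(* [q] needs the set of indices from stages before [i]. As [i] is at most [j], these stages are
   available to the recursion, and [HG] rewrites the set as [H i]. *)
have [G0 HG0] := wo_rec O (I -> Prop) (fun j rec =>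
  seq_closure A (fun a => ~ wo_lt j (e a))
   (fun i b x => ~ wo_lt j i /\
      q (N i) (fun g => exists k, wo_lt k i /\ exists p : wo_lt k j, rec k p g) b x)).
pose H i g := exists k, wo_lt k i /\ G0 k g.
pose Z j i b x := ~ wo_lt j i /\ q (N i) (H i) b x.
have HG j : G0 j = seq_closure A (fun a => ~ wo_lt j (e a)) (Z j).
  rewrite HG0; congr (seq_closure A _ _).
  apply: functional_extensionality_dep => i; apply: functional_extensionality_dep => b.
  apply: functional_extensionality_dep => x; rewrite /Z.
  case: (EM (wo_lt j i)) => ji; first by apply: propext; split; case.
  suff -> : (fun g => exists k, wo_lt k i /\ exists p : wo_lt k j, G0 k g) = H i by [].
  apply: functional_extensionality_dep => g; apply: propext.
  split=> [[k [ki [_ Gk]]]|[k [ki Gk]]]; exists k; split=> //.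
  by exists (wo_lt_nlt _ _ _ _ ki ji).
clear HG0.
have Gmono i j a : ~ wo_lt j i -> G0 i a -> G0 j a.
  move=> ij; rewrite !HG; apply: seq_closure_mono => [b ib|k b x [ik qx]].
    exact: wo_nlt_trans ib ij.
  by split=> //; exact: wo_nlt_trans ik ij.
have Gcard j : card_le {a | G0 j a} (N j).
  (* The closure is coded by sequences in [N j], that is, by sequences of sequences in [L j]. *)
  rewrite HG; apply: card_le_trans (card_le_seq_seq (L j)).
  apply: (seq_closure_card _ _ _ _ _ _ _ fm (nN j)).
    apply: card_le_trans (segN j).
    apply: (sub_card_le _ _ _ (fun a y => e a = proj1_sig y)).
      by move=> a ja; exists (exist _ (e a) ja).
    by move=> x y b _ _ E1 E2; apply: ei; rewrite E1 E2.
  move=> b; apply: card_le_trans (card_le_square (N j) (nN j)).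
  apply: (card_le_trans {p : O * X | exists i, ~ wo_lt j i /\
      (fst p = i /\ q (N i) (H i) b (snd p))}).
    by apply: sub_card_mono => -[i x] [/= ji qx]; exists i.
  apply: card_le_union; first exact: segN.
  move=> i ji; apply: card_le_trans (Nmono i j ji).
  apply: card_le_trans (Hq (N i) (H i) b (KN i)).
  apply: (sub_card_le _ _ _ (fun p x => snd p = proj1_sig x)).
    by move=> [i' x] [_ /= qx]; exists (exist _ x qx).
  by move=> [i1 x] [i2 y] z /= [-> _] [-> _] -> ->.
have /choice [r Hr] : forall a, exists i, G0 i a /\ forall j, G0 j a -> ~ wo_lt j i.
  move=> a; apply: wo_min; exists (e a); rewrite HG; apply: closure_base.
  exact: wo_irrefl.
have rG a i : G0 i a <-> ~ wo_lt i (r a).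
  split=> [|ia]; first exact: (proj2 (Hr a)).
  by apply: Gmono (proj1 (Hr a)).
exists O, r, N; split.
  move=> i; split=> //; split=> //; apply: card_le_trans (Gcard i).
  by apply: sub_card_mono => a /rG.
have HE i : (fun g => wo_lt (r g) i) = H i.
  apply: functional_extensionality_dep => g; apply: propext.
  split=> [l|[k [ki /rG kg]]]; last exact: wo_nlt_lt kg ki.
  by exists (r g); split=> //; case: (Hr g).
move=> a; apply: contrapT => nU; set U := (fun x => _) in nU.
have /choice [be Hbe] : forall x, exists b, U x ->
    wo_lt (r b) (r a) /\ q (N (r b)) (H (r b)) b x.
  move=> x; case: (EM (U x)) => [[_ [b [l qx]]]|n]; last by exists a.
  by exists b => _; split=> //; rewrite -HE.
have [u [Uu [s [si Hs]]]] := uncountable_has_infinite_initial_part _ _ _ (fun x => r (be x)) nU.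
have [ua _] := Hbe u Uu.
suff : G0 (r (be u)) a by move/rG; apply.
rewrite HG; apply: (closure_capture _ _ _ _ (fun n => be (s n)) (fun n => r (be (s n))) s) => //.
- by move=> n; rewrite -HG; apply/rG; case: (Hs n).
- by move=> n; have [Un l] := Hs n; split=> //; case: (Hbe _ Un).
- by move=> n; case: (Hs n) => -[].
Qed.

(** If [theta] is not closed under countable sequences, it is at most [nat -> M] for an initial [M]
    below it. CH makes [M] uncountable, [not_cof_omega_seq] gives it cofinality omega, and then
    [theta] embeds in its successor [P], which carries a square sequence. *)
Lemma filtration_exists (W1 : Type) (HW1 : is_succ_card nat W1)
  (lam : Type) (Hlam : card_lt nat lam)
  (Hi : forall M : WO, initial_ordinal M -> card_lt M lam -> cof_omega M ->
          is_succ_card M (nat -> M))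
  (Hii : forall M : WO, initial_ordinal M -> card_lt M lam -> singular M ->
          cof_omega M -> square M)
  (theta : Type) (Wth : card_lt W1 theta) (thl : card_le theta lam)
  (I X : Type) (A : I -> X -> Prop) (fm : finite_meets A) (Ith : card_le I theta)
  (K0 : Type) (WK : card_le W1 K0) (Kth : card_lt K0 theta)
  (q : Type -> (I -> Prop) -> I -> X -> Prop)
  (Hq : forall N H b, card_le K0 N -> card_le {x | q N H b x} N) :
  filtration A theta K0 q.
Proof.
have nW : card_le nat W1 by case: HW1 => -[].
case: (EM (forall T : Type, card_lt T theta -> card_lt (nat -> T) theta)) => [seqth|N].
  have [O [Oi [thO Oth]]] := exists_initial theta.
  have [e ei] := card_le_trans _ _ _ Ith thO.
  have [|||W [r [N [HN HU]]]] := filtration_seq_closed O Oi I X A fm e ei K0 _ _ _ q Hq.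
  - exact: card_le_trans nW WK.
  - exact: card_lt_le_trans Kth thO.
  - move=> T TO; apply: card_lt_le_trans thO; apply: seqth; exact: card_lt_le_trans TO Oth.
  exists W, r, N; split=> // i; have [NO HN'] := HN i; split=> //.
  exact: card_lt_le_trans NO Oth.
have [T [Tth thT]] : exists T, card_lt T theta /\ card_le theta (nat -> T).
  apply: contrapT => N'; apply: N => T Tth; apply: contrapT => l.
  by apply: N'; exists T; split=> //; exact: card_nlt_le.
have [M [Mi [TM MT]]] := exists_initial T.
have Mth : card_lt M theta by exact: card_le_lt_trans MT Tth.
have Ml : card_lt M lam by exact: card_lt_le_trans Mth thl.
have thM : card_le theta (nat -> M) by apply: card_le_trans thT _; exact: card_le_seq.
have seqle Y Z : card_le Y lam -> card_le W1 Y -> card_lt Z Y -> card_le (nat -> Z) Y.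
  move=> Yl WY; exact: seq_card_le HW1 Hlam Hi Y Yl WY Z.
have nM : card_lt nat M.
  apply: card_nle_lt => Mn; case: (Wth) => _; apply; apply: card_le_trans thM _.
  apply: (card_le_trans (nat -> nat)); first exact: card_le_seq.
  apply: seqle; [|exact: card_le_refl|by case: HW1].
  by case: HW1 => _; apply.
have WM : card_le W1 M by case: HW1 => _; apply.
have seqM Y : card_lt Y M -> card_le (nat -> Y) M by apply: seqle => //; case: Ml.
have cofM : cof_omega M.
  apply: contrapT => nc; case: (Mth) => _; apply; apply: card_le_trans thM _.
  by apply: not_cof_omega_seq => //; case: nM.
have [P [Pi [Ps [C HC]]]] := Hii M Mi Ml (cof_omega_singular M nM cofM) cofM.
have [MP Pmin] := Ps.
have thP : card_le theta P.
  by apply: card_le_trans thM _; have [_] := Hi M Mi Ml cofM; apply.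
have [e ei] := card_le_trans _ _ _ Ith thP.
apply: (filtration_square M P Mi nM cofM seqM Pi Ps C HC I X A fm e ei) => //.
(* [K0] is below [theta], which is at most the successor of [M]. *)
apply: card_nlt_le => MK; case: (Kth) => _; apply; apply: card_le_trans thP _.
exact: Pmin.
Qed.

(** * Nice families and the colouring *)

(** Relative to [S], so that a single level of a rank can be treated inside the full index type. *)
Definition nice_on {I X : Type} (S : I -> Prop) (A A' : I -> X -> Prop) : Prop :=
  forall a, S a -> (forall x, A' a x -> A a x) /\ ~ countable (A' a) /\
    countable (fun x => A a x /\ exists b, S b /\ b <> a /\ A' b x).

Lemma uncountable_card (W1 X : Type) (P : X -> Prop) :
  is_succ_card nat W1 -> card_le W1 {x | P x} -> ~ countable P.
Proof. by move=> [[_ nW] _] WP cP; apply: nW; apply: card_le_trans WP cP. Qed.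

Lemma card_le_split (X : Type) (P C : X -> Prop) :
  card_le {x | P x} ({x | P x /\ ~ C x} + {x | P x /\ C x}).
Proof.
apply: (sub_card_le _ _ _ (fun x s => match s with
   | inl u => x = proj1_sig u | inr u => x = proj1_sig u end)).
  move=> x Px; case: (EM (C x)) => Cx; first by exists (inr (exist _ x (conj Px Cx))).
  by exists (inl (exist _ x (conj Px Cx))).
by move=> x y [u|u] _ _ -> ->.
Qed.

Lemma card_diff (X N : Type) (P C : X -> Prop) : card_le nat N ->
  ~ card_le {x | P x} N -> card_le {x | P x /\ C x} N ->
  card_le N {x | P x /\ ~ C x} /\ card_le {x | P x} {x | P x /\ ~ C x}.
Proof.
move=> nN PN CN; pose Y := ({x | P x /\ ~ C x})%type.
have NY : card_le N Y.
  case: (card_le_total N Y) => // YN; case: PN.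
  by apply: card_le_trans (card_le_split _ P C) _; exact: card_le_sum.
split=> //; apply: card_le_trans (card_le_split _ P C) _; apply: card_le_sum.
- exact: card_le_trans nN NY.
- exact: card_le_refl.
- exact: card_le_trans CN NY.
Qed.

(** Remove from each set its points in earlier sets: countably many predecessors, each sharing
    finitely many points. *)
Lemma nice_small (W1 : Type) (HW1 : is_succ_card nat W1) (I X : Type)
  (A : I -> X -> Prop) : finite_meets A -> card_le I W1 ->
  (forall a, ~ countable (A a)) -> exists A', nice_on (fun _ => True) A A'.
Proof.
move=> fm IW unc; have [O [Oi [WO OW]]] := exists_initial W1.
have [e ei] := card_le_trans _ _ _ IW WO.
have cE a : countable (fun x => exists b, wo_lt (e b) (e a) /\ A a x /\ A b x).
  apply: card_le_trans nat_prod_le; apply: card_le_union.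
    apply: (card_le_trans {y : O | wo_lt y (e a)}).
      apply: (sub_card_le _ _ _ (fun b y => e b = proj1_sig y)).
        by move=> b l; exists (exist (fun y => wo_lt y (e a)) _ l).
      by move=> x y b _ _ E1 E2; apply: ei; rewrite E1 E2.
    apply: card_nlt_le => /(proj2 HW1) Wl; case: (Oi (e a)) => _; apply.
    exact: card_le_trans OW Wl.
  move=> b ba; apply: not_infinite_countable => /fm ab.
  by rewrite ab in ba; exact: wo_irrefl ba.
exists (fun a x => A a x /\ ~ exists b, wo_lt (e b) (e a) /\ A a x /\ A b x) => a _.
split; [by move=> x []|split].
  move=> c; apply: (unc a); apply: countable_mono (countable_or _ _ _ c (cE a)).
  move=> x Ax; case: (EM (exists b, wo_lt (e b) (e a) /\ A a x /\ A b x)); first by right.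
  by left.
apply: countable_mono (cE a) => x [Ax [b [_ [ba [Bx nb]]]]]; exists b.
case: (wo_total O (e b) (e a)) => [//|[/ei //|l]].
by case: nb; exists a.
Qed.

(** Points of [A a] in [A' b] are countably many by [cQ] if [b] has smaller rank and by niceness of
    the level if the ranks agree; there are none if [b] has larger rank, since [Q] avoids sets of
    smaller rank. *)
Lemma nice_glue (I X : Type) (W : WO) (A Q : I -> X -> Prop) (r : I -> W) :
  (forall a x, Q a x -> A a x /\ ~ exists b, wo_lt (r b) (r a) /\ A b x) ->
  (forall a, countable (fun x => A a x /\ exists b, wo_lt (r b) (r a) /\ Q b x)) ->
  (forall i, exists A', nice_on (fun a => r a = i)
     (fun a x => A a x /\ exists b, r b = i /\ Q b x) A') ->
  exists A', nice_on (fun _ => True) A A'.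
Proof.
move=> QA cQ /choice [A' HA']; exists (fun a => A' (r a) a) => a _.
have sub b x : A' (r b) b x -> A b x /\ exists c, r c = r b /\ Q c x.
  exact: (proj1 (HA' (r b) b erefl)).
have [_ [unc cnt]] := HA' (r a) a erefl.
split; [by move=> x /sub []|split=> //].
apply: countable_mono (countable_or _ _ _ (cQ a) cnt) => x [Ax [b [_ [ba A'x]]]].
have [Bx [c [cb Qx]]] := sub b x A'x.
case: (wo_total W (r b) (r a)) => [l|[E|l]].
- by left; split=> //; exists c; rewrite cb.
- right; split; first by split=> //; exists c; rewrite cb.
  by exists b; rewrite -E.
- by case: (QA c x Qx) => _; case; exists a; rewrite cb.
Qed.

(** The alternative on [K] survives the induction: either the sets are at least as large as the
    number of indices allows, or all have size exactly [K]. In the second case with [K] below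
    [theta], whole sets are used as the parts [q]. *)
Lemma nice_exists (W1 : Type) (HW1 : is_succ_card nat W1)
  (lam : Type) (Hlam : card_lt nat lam)
  (Hi : forall M : WO, initial_ordinal M -> card_lt M lam -> cof_omega M ->
          is_succ_card M (nat -> M))
  (Hii : forall M : WO, initial_ordinal M -> card_lt M lam -> singular M ->
          cof_omega M -> square M)
  (X theta : Type) : card_le theta lam ->
  forall (I : Type) (A : I -> X -> Prop) (K : Type),
  card_le I theta -> finite_meets A -> card_le W1 K ->
  (forall a, card_le K {x | A a x}) ->
  (card_le theta K \/ forall a, card_le {x | A a x} K) ->
  exists A', nice_on (fun _ => True) A A'.
Proof.
have nW : card_le nat W1 by case: HW1 => -[].
elim/card_ind: theta => theta IH thl I A K Ith fm WK KA cases.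
have unc a : ~ countable (A a).
  by apply: (uncountable_card W1) => //; apply: card_le_trans WK _.
case: (EM (card_le theta W1)) => [thW|/card_nle_lt Wth].
  apply: (nice_small W1 HW1) => //; exact: card_le_trans Ith thW.
have IHsub (S : I -> Prop) (B : I -> X -> Prop) (N L : Type) : card_lt N theta ->
    card_le {a | S a} N -> (forall a x, B a x -> A a x) -> card_le W1 L ->
    (forall a, S a -> card_le L {x | B a x}) ->
    (card_le N L \/ forall a, S a -> card_le {x | B a x} L) ->
    exists B', nice_on S B B'.
  move=> Nth SN BA WL LB cs.
  have [||||B' HB'] := IH N Nth _ {a | S a} (fun a => B (proj1_sig a)) L SN _ WL.
  - by apply: card_le_trans thl; case: Nth.
  - move=> [a Sa] [b Sb] /= inf; apply: eq_exist; apply: fm.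
    by apply: infinite_mono inf => x [] /BA ? /BA ?.
  - by move=> [a Sa]; exact: LB.
  - by case: cs => [?|H]; [left | right=> -[a Sa]; exact: H].
  exists (fun a x => exists p : S a, B' (exist _ a p) x) => a Sa.
  have [sub [nc cn]] := HB' (exist _ a Sa) Logic.I; split; last split.
  - by move=> x [p /(proj1 (HB' (exist _ a p) Logic.I))].
  - move=> c; apply: nc; apply: countable_mono c => x Bx; by exists Sa.
  - apply: countable_mono cn => x [Bx [b [Sb [ba [p B'x]]]]]; split=> //.
    by exists (exist _ b p); split=> //; split=> // -[].
case: (EM (card_lt K theta)) => [Kth|/card_nlt_le thK].
  have AK a : card_le {x | A a x} K by case: cases => // thK; case: Kth.
  have [|W [r [N [HN HU]]]] := filtration_exists W1 HW1 lam Hlam Hi Hii theta Wth thl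
    I X A fm Ith K WK Kth (fun N H b => A b).
    by move=> N _ b KN; exact: card_le_trans (AK b) KN.
  pose Q a x := A a x /\ ~ exists b, wo_lt (r b) (r a) /\ A b x.
  apply: (nice_glue _ _ W A Q r) => //.
    move=> a; apply: countable_mono (HU a) => x [Ax [b [l [Bx _]]]].
    by split=> //; exists b.
  move=> i; have [Nth [KN rN]] := HN i; apply: (IHsub _ _ (N i) K) => //.
  - apply: card_le_trans rN; apply: sub_card_mono => a ->; exact: wo_irrefl.
  - by move=> a x [].
  - move=> a ai; apply: card_le_trans (KA a) _.
    (* Only countably many points of [A a] lie in sets of smaller rank, so its size is kept. *)
    have [|_ le] := card_diff X nat (A a)
      (fun x => exists b, wo_lt (r b) (r a) /\ A b x) (card_le_refl _) (unc a).
      apply: countable_mono (HU a) => x [Ax [b [l Bx]]]; split=> //; by exists b.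
    apply: card_le_trans le _; apply: sub_card_mono => x Qx.
    by split; [case: Qx | exists a].
  - right=> a _; apply: card_le_trans (AK a); by apply: sub_card_mono => x [].
have selP (N : Type) (H : I -> Prop) (b : I) : exists Y : X -> Prop,
    card_le {x | Y x} N /\
    (card_le N {x | A b x /\ ~ exists g, H g /\ A g x} ->
     card_le N {x | Y x} /\ forall x, Y x -> A b x /\ ~ exists g, H g /\ A g x).
  case: (EM (card_le N {x | A b x /\ ~ exists g, H g /\ A g x})) => [[f fi]|n]; last first.
    exists (fun _ => False); split; last by move=> /n.
    by apply: (sub_card_le _ _ _ (fun _ _ => True)).
  exists (fun x => exists n, proj1_sig (f n) = x); split=> [|_]; last split.
  - apply: (sub_card_le _ _ _ (fun x n => proj1_sig (f n) = x)) => //.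
    by move=> x y n _ _ -> ->.
  - exists (fun n => exist _ (proj1_sig (f n)) (ex_intro _ n erefl)) => m n [] E.
    by apply: fi; move: E; case: (f m) => ? ?; case: (f n) => ? ? /= E; exact: eq_exist.
  - move=> x [n <-]; exact: (proj2_sig (f n)).
(* When every [A a] has size at least [theta], only [N]-many points of it outside
   the earlier sets are kept. *)
pose q N H b := sval (cid (selP N H b)).
have Hq N H b := svalP (cid (selP N H b)).
have [|W [r [N [HN HU]]]] := filtration_exists W1 HW1 lam Hlam Hi Hii theta Wth thl
  I X A fm Ith W1 (card_le_refl _) Wth q.
  by move=> N H b _; case: (Hq N H b).
pose Q a := q (N (r a)) (fun g => wo_lt (r g) (r a)) a.
(* At most [N (r a)] points are lost to earlier sets, while [A a] has at least [theta] points, which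
   is more. *)
have HQ a : card_le (N (r a)) {x | Q a x} /\
    forall x, Q a x -> A a x /\ ~ exists b, wo_lt (r b) (r a) /\ A b x.
  apply: (proj2 (Hq _ _ _)); have [Nth [WN rN]] := HN (r a).
  have nN := card_le_trans _ _ _ nW WN.
  have [||//] := card_diff X (N (r a)) (A a)
    (fun x => exists b, wo_lt (r b) (r a) /\ A b x) nN.
    move=> AN; case: Nth => _; apply; apply: card_le_trans thK _.
    exact: card_le_trans (KA a) AN.
  apply: card_le_trans (card_le_square _ nN).
  apply: (card_le_trans {x | exists b, wo_lt (r b) (r a) /\ (A a x /\ A b x)}).
    by apply: sub_card_mono => x [Ax [b [l Bx]]]; exists b.
  apply: card_le_union.
    apply: card_le_trans rN; apply: sub_card_mono => b ba ab.
    exact: (wo_irrefl _ _ (wo_trans _ _ _ _ ba ab)).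
  move=> b ba; apply: card_le_trans nN; apply: not_infinite_countable => /fm ab.
  by rewrite ab in ba; exact: wo_irrefl ba.
apply: (nice_glue _ _ W A Q r).
- by move=> a; exact: (proj2 (HQ a)).
- exact: HU.
move=> i; have [Nth [WN rN]] := HN i; apply: (IHsub _ _ (N i) (N i)) => //.
- apply: card_le_trans rN; apply: sub_card_mono => a ->; exact: wo_irrefl.
- by move=> a x [].
- move=> a ai; have [NQ QA] := HQ a; rewrite -ai; apply: card_le_trans NQ _.
  apply: sub_card_mono => x Qx; split; [by case: (QA x Qx) | by exists a].
- by left; exact: card_le_refl.
Qed.

(** * From a nice family to a colouring *)

Lemma countable_image (X Y : Type) (f : X -> Y) (P : X -> Prop) :
  countable P -> countable (fun y => exists x, P x /\ f x = y).
Proof.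
move=> /sub_card_code [R [Rex Ri]].
apply: (sub_card_le _ _ _ (fun y n => exists x, f x = y /\ R x n)).
  by move=> y [x [Px <-]]; have [n Rn] := Rex x Px; exists n, x.
by move=> y y' n _ _ [x [<- Rx]] [x' [<- Rx']]; rewrite (Ri _ _ _ Rx Rx').
Qed.

(** The sets [D a] are disjoint and uncountable, so [W1] embeds in each by [g a]; [f] inverts these
    maps and is [w0] elsewhere. On [A a] a colour can recur only if it is [w0] or the colour of one
    of the countably many points in another [A' b]. *)
Lemma nice_coloring (W1 : Type) (HW1 : is_succ_card nat W1) (I X : Type)
  (A A' : I -> X -> Prop) : nice_on (fun _ => True) A A' ->
  exists f : X -> W1, forall a, card_lt {xi | ~ I_f f (A a) xi} W1.
Proof.
move=> HA; have [w0] : inhabited W1 by case: HW1 => -[[f _] _] _; split; exact: f 0.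
pose D a x := A' a x /\ ~ exists b, b <> a /\ A' b x.
have /choice [g Hg] : forall a, exists g : W1 -> X,
    (forall v w, g v = g w -> v = w) /\ forall w, D a (g w).
  move=> a; have [sub [unc cnt]] := HA a Logic.I.
  have [|g gi] := succ_nat_le W1 {x | D a x} HW1.
    move=> cD; apply: unc; apply: countable_mono (countable_or _ _ _ cD cnt) => x A'x.
    case: (EM (exists b, b <> a /\ A' b x)) => [[b [ba Bx]]|n]; last by left.
    by right; split; [exact: sub | exists b].
  exists (fun w => proj1_sig (g w)); split=> [v w E|w]; last exact: proj2_sig.
  by apply: gi; move: E; case: (g v) => ? ?; case: (g w) => ? ? /= E; exact: eq_exist.
have /choice [f Hf] : forall x, exists w,
    (exists a, g a w = x) \/ ~ (exists a v, g a v = x) /\ w = w0.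
  move=> x; case: (EM (exists a v, g a v = x)) => [[a [v E]]|n]; last by exists w0; right.
  by exists v; left; exists a.
have fg a w : f (g a w) = w.
  case: (Hf (g a w)) => [[b E]|[n _]]; last by case: n; exists a, w.
  suff ba : b = a by rewrite ba in E; exact: (proj1 (Hg a)) E.
  apply: contrapT => ba; have [_] := proj2 (Hg a) w; apply; exists b; split=> //.
  by rewrite -E; case: (proj2 (Hg b) (f (g a w))).
exists f => a; have [sub [_ cnt]] := HA a Logic.I.
apply: (card_le_lt_trans nat); last by case: HW1.
have c0 : countable (fun w => w = w0).
  by apply: (sub_card_le _ _ _ (fun _ _ => True)) => [*|x y _ -> ->]; [exists 0|].
apply: countable_mono (countable_or _ _ _ c0 (countable_image _ _ f _ cnt)) => w nI.
apply: contrapT => N; apply: nI; exists (g a w); split.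
  by split=> //; apply: sub; case: (proj2 (Hg a) w).
move=> x [Ax fx]; case: (Hf x) => [[b E]|[_ E]]; last by case: N; left; rewrite -fx.
rewrite fx in E; case: (EM (b = a)) => [<- //|ba].
case: N; right; exists x; split=> //; split=> //; exists b; split=> //; split=> //.
by rewrite -E; case: (proj2 (Hg b) w).
Qed.

Theorem theorem8p7 (W1 : Type) (HW1 : is_succ_card nat W1)
  (lam : Type) (Hlam : card_lt nat lam)
  (Hi : forall M : WO, initial_ordinal M -> card_lt M lam -> cof_omega M ->
          is_succ_card M (nat -> M))
  (Hii : forall M : WO, initial_ordinal M -> card_lt M lam -> singular M ->
          cof_omega M -> square M)
  (kap : Type) (Hk1 : card_le W1 kap) (Hk2 : card_le kap lam) :
  arrows lam kap nat W1.
Proof.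
move=> X F [[f1 [g1 [E1 _]]] [Hkap Hmeet]].
pose A (a : {A : X -> Prop | F A}) := proj1_sig a.
have [|||||A' HA'] := nice_exists W1 HW1 lam Hlam Hi Hii X lam (card_le_refl _)
  {A : X -> Prop | F A} A kap.
- by exists f1 => x y E; rewrite -(E1 x) -(E1 y) E.
- move=> [B FB] [C FC] inf; apply: eq_exist; apply: contrapT => BC.
  case: (Hmeet B C FB FC BC) => _; apply; exact/infinite_card.
- exact: Hk1.
- move=> [B FB]; have [f [g [_ fg]]] := Hkap B FB.
  by exists g => x y E; rewrite -(fg x) -(fg y) E.
- right=> -[B FB]; have [f [g [gf _]]] := Hkap B FB.
  by exists f => x y E; rewrite -(gf x) -(gf y) E.
have [f Hf] := nice_coloring W1 HW1 _ X A A' HA'.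
by exists f => B FB; exact: (Hf (exist _ B FB)).
Qed.
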